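(* Let $G$ be a graph, let $\ell\ge 1$ be an integer, and let $f$ be an $\ell$-rainbow domination function of $G$ with $w(f)=\gamma_{r\ell}(G)$. For $i\in\{1,\dots,\ell\}$ define $U_i=\{v\in V(G)\mid i\in f(v)\}$, so that $\gamma_{r\ell}(G)=|U_1|+|U_2|+\dots+|U_\ell|$. Then $$\gamma_{r(\ell+1)}(G)\;\le\;\gamma_{r\ell}(G)+\min_{1\le i\le \ell}|U_i|\;\le\;\gamma_{r\ell}(G)+\left\lfloor\frac{\gamma_{r\ell}(G)}{\ell}\right\rfloor\;=\;\left\lfloor\frac{\ell+1}{\ell}\,\gamma_{r\ell}(G)\right\rfloor .$$
   Context: Graphs are finite and simple. For a graph $G$ and an integer $t\ge 1$, a $t$-rainbow domination function is a map $g$ assigning to each vertex $v$ a (possibly empty) subset $g(v)\subseteq\{1,2,\dots,t\}$ such that every vertex $v$ with $g(v)=\emptyset$ satisfies $\bigcup_{u\text{ neighbor of }v} g(u)=\{1,2,\dots,t\}$. Its weight is $w(g)=\sum_{v\in V(G)}|g(v)|$. The $t$-rainbow domination number $\gamma_{rt}(G)$ is the minimum weight over all $t$-rainbow domination functions of $G$. *)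

(* Defs.v *)
From HB Require Import structures.
From mathcomp Require Export all_boot all_order all_algebra.

Set Implicit Arguments.
Unset Strict Implicit.
Unset Printing Implicit Defensive.

(* A finite simple graph is a symmetric irreflexive relation [e] on a finite
   type [T] of vertices.  The colours 1, ..., t are encoded as the elements
   0, ..., t - 1 of ['I_t]. *)

Definition rainbow_dom (T : finType) (e : rel T) (t : nat)
    (g : {ffun T -> {set 'I_t}}) : bool :=
  [forall v, (g v == set0) ==> (\bigcup_(u | e v u) g u == [set: 'I_t])].

Definition weight (T : finType) (t : nat) (g : {ffun T -> {set 'I_t}}) : nat :=
  \sum_(v : T) #|g v|.

Definition full_coloring (T : finType) (t : nat) : {ffun T -> {set 'I_t}} :=
  [ffun=> [set: 'I_t]].

Lemma full_coloring_rainbow_dom (T : finType) (e : rel T) (t : nat) :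
  rainbow_dom e (full_coloring T t).
Proof.
apply/forallP => v; apply/implyP; rewrite ffunE => /eqP full0.
by apply/eqP/setP => i; have := in_setT i; rewrite full0 inE.
Qed.

(* [full_coloring] only witnesses that the minimum is over a nonempty set. *)
Definition rainbow_number (T : finType) (e : rel T) (t : nat) : nat :=
  weight [arg min_(g < full_coloring T t | rainbow_dom e g) weight g].

Lemma rainbow_numberP (T : finType) (e : rel T) (t : nat) :
  (exists2 g : {ffun T -> {set 'I_t}},
     rainbow_dom e g & weight g = rainbow_number e t) /\
  (forall g : {ffun T -> {set 'I_t}},
     rainbow_dom e g -> rainbow_number e t <= weight g).
Proof.
rewrite /rainbow_number.
case: arg_minnP => [|g dom_g min_g]; first exact: full_coloring_rainbow_dom.
by split=> //; exists g.
Qed.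

Definition color_class (T : finType) (t : nat) (g : {ffun T -> {set 'I_t}})
    (i : 'I_t) : {set T} :=
  [set v | i \in g v].

(* [t_gt0] supplies a colour, so that the minimum over all colours exists. *)
Definition min_color_class (T : finType) (t : nat) (t_gt0 : 0 < t)
    (g : {ffun T -> {set 'I_t}}) : nat :=
  #|color_class g [arg min_(i < Ordinal t_gt0) #|color_class g i|]|.

(* Main.v *)
Require Import Defs.
From mathcomp Require Import all_boot all_order all_algebra.

(** Give every vertex that uses colour [i] one extra, brand-new colour. The new
    colour then occurs exactly where [i] does, so whichever neighbourhood sees
    [i] also sees it, and the weight grows by the size of the class of [i].
    Doing this with a least used colour gives the first inequality, and the
    second one holds because the least of [l] numbers is at most their average,
    which is the weight divided by [l]. The last equality only moves the integer
    summand of [(l + 1) / l * w = w + w / l] out of the floor.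

    Duplicating a colour is an instance of pulling a colouring back along a map
    of palettes [s : 'I_m -> 'I_n] ([recolor]). The classes of the pullback are
    classes of the original colouring ([color_class_recolor]), so its weight is
    read off from the count of the weight by classes ([weight_color_class]); and
    domination survives as soon as [s] is surjective ([recolor_rainbow_dom]). *)

Set Implicit Arguments.
Unset Strict Implicit.
Unset Printing Implicit Defensive.

Import GRing.Theory Num.Theory.

Lemma weight_color_class (T : finType) (t : nat) (g : {ffun T -> {set 'I_t}}) :
  weight g = \sum_(i < t) #|color_class g i|.
Proof.
rewrite /weight; under eq_bigr do rewrite -sum1_card big_mkcond.
rewrite exchange_big; apply: eq_bigr => i _.
by rewrite -sum1_card [RHS]big_mkcond; apply: eq_bigr => v _; rewrite inE.
Qed.

Lemma min_color_class_le_average (T : finType) (t : nat) (t_gt0 : 0 < t)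
    (g : {ffun T -> {set 'I_t}}) :
  min_color_class t_gt0 g * t <= weight g.
Proof.
rewrite weight_color_class /min_color_class; case: arg_minnP => // i _ min_i.
rewrite mulnC -{1}(card_ord t) -sum_nat_const.
by apply: leq_sum => j _; apply: min_i.
Qed.

Definition recolor (T : finType) (m n : nat) (s : 'I_m -> 'I_n)
    (g : {ffun T -> {set 'I_n}}) : {ffun T -> {set 'I_m}} :=
  [ffun v => s @^-1: g v].

Lemma color_class_recolor (T : finType) (m n : nat) (s : 'I_m -> 'I_n)
    (g : {ffun T -> {set 'I_n}}) (c : 'I_m) :
  color_class (recolor s g) c = color_class g (s c).
Proof. by apply/setP => v; rewrite !inE ffunE inE. Qed.

(** Surjectivity ensures that no vertex loses all its colours, so only the
    vertices that were empty before need a rainbow neighbourhood. That one is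
    inherited, because preimages commute with unions. *)
Lemma recolor_rainbow_dom (T : finType) (e : rel T) (m n : nat)
    (s : 'I_m -> 'I_n) (g : {ffun T -> {set 'I_n}}) :
  (forall i, exists c, s c = i) -> rainbow_dom e g ->
  rainbow_dom e (recolor s g).
Proof.
move=> s_surj /forallP g_dom; apply/forallP => v; apply/implyP => /eqP hv0.
have gv0 : g v == set0.
  apply/eqP/setP => i; have [c <-] := s_surj i.
  by have := in_set0 c; rewrite -hv0 ffunE !inE.
apply/eqP/setP => c; rewrite inE; apply/bigcupP.
have : s c \in \bigcup_(u | e v u) g u.
  by rewrite (eqP (implyP (g_dom v) gv0)) inE.
by case/bigcupP => u evu gu; exists u; rewrite // ffunE inE.
Qed.

(** The palette map that adds the new colour [ord0], as a copy of [i]. *)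
Definition merge_color (n : nat) (i : 'I_n) (c : 'I_n.+1) : 'I_n :=
  odflt i (unlift ord0 c).

(** Colouring pulled back along [merge_color i]: the classes of the old colours
    keep their sizes, and the class of [ord0] contributes [#|color_class g i|]. *)
Lemma rainbow_numberS_le (T : finType) (e : rel T) (t : nat)
    (g : {ffun T -> {set 'I_t}}) (i : 'I_t) :
  rainbow_dom e g ->
  rainbow_number e t.+1 <= weight g + #|color_class g i|.
Proof.
move=> g_dom.
have mergeK j : merge_color i (lift ord0 j) = j by rewrite /merge_color liftK.
have h_dom : rainbow_dom e (recolor (merge_color i) g).
  by apply: recolor_rainbow_dom => // j; exists (lift ord0 j).
apply: leq_trans ((rainbow_numberP e t.+1).2 _ h_dom) _.
rewrite !weight_color_class big_ord_recl color_class_recolor.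
rewrite {1}/merge_color unlift_none addnC leq_add2r.
by apply: leq_sum => j _; rewrite color_class_recolor mergeK.
Qed.

Theorem theorem13 (T : finType) (e : rel T)
    (e_sym : symmetric e) (e_irr : irreflexive e)
    (l : nat) (l_gt0 : (0 < l)%N)
    (f : {ffun T -> {set 'I_l}})
    (f_dom : rainbow_dom e f)
    (f_min : weight f = rainbow_number e l) :
  [/\ rainbow_number e l = (\sum_(i < l) #|color_class f i|)%N,
      (rainbow_number e l.+1 <= rainbow_number e l + min_color_class l_gt0 f)%N,
      ((rainbow_number e l)%:Z + (min_color_class l_gt0 f)%:Z
        <= (rainbow_number e l)%:Z
           + Num.floor ((rainbow_number e l)%:Q / l%:Q))%R
    & ((rainbow_number e l)%:Z + Num.floor ((rainbow_number e l)%:Q / l%:Q)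
        = Num.floor (l.+1%:Q / l%:Q * (rainbow_number e l)%:Q))%R].
Proof.
rewrite -f_min; split.
- exact: weight_color_class.
- exact: rainbow_numberS_le.
- rewrite lerD2l floor_ge_int ler_pdivlMr ?ltr0n //.
  by rewrite -!pmulrn -natrM ler_nat min_color_class_le_average.
- have l_neq0 : (l%:Q != 0)%R by rewrite intr_eq0 -lt0n.
  have -> : (l.+1%:Q / l%:Q * (weight f)%:Q
             = (weight f)%:~R + (weight f)%:Q / l%:Q)%R.
    by rewrite -addn1 PoszD intrD mulrDl divff // mulrDl !mul1r mulrC.
  by rewrite floorDzr ?intr_int // intrKfloor.
Qed.
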